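(* Let $\alpha<\beta$ be real numbers and let $\mathbf{x}=(x_1,\dots,x_l)\in[\alpha,\beta]^l$, $\mathbf{y}=(y_1,\dots,y_m)\in[\alpha,\beta]^m$, $\mathbf{a}=(a_1,\dots,a_l)\in[0,\infty)^l$ and $\mathbf{b}=(b_1,\dots,b_m)\in[0,\infty)^m$ be such that $(\mathbf{y},\mathbf{b})\prec(\mathbf{x},\mathbf{a})$. Let $B_m=\sum_{i=1}^m b_i$. If $f:[\alpha,\beta]\to\mathbb{R}$ is strongly convex with modulus $c>0$, then $$\sum_{j=1}^{l}a_jf(x_j)\le\frac{B_m\beta-\sum_{j=1}^{l}a_jx_j}{\beta-\alpha}f(\alpha)+\frac{\sum_{j=1}^{l}a_jx_j-B_m\alpha}{\beta-\alpha}f(\beta)-c\sum_{j=1}^{l}a_j(\beta-x_j)(x_j-\alpha).$$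
   Context: A function $f:[\alpha,\beta]\to\mathbb{R}$ is strongly convex with modulus $c>0$ if $f(\lambda x+(1-\lambda)y)\le\lambda f(x)+(1-\lambda)f(y)-c\lambda(1-\lambda)(x-y)^2$ for all $x,y\in[\alpha,\beta]$ and $\lambda\in[0,1]$. Weighted majorization: $(\mathbf{y},\mathbf{b})\prec(\mathbf{x},\mathbf{a})$ means that there exists a row stochastic matrix $\mathbf{A}=(a_{ij})\in\mathcal{M}_{ml}(\mathbb{R})$ ($m$ rows, $l$ columns, nonnegative entries, each row sum equal to $1$) such that $a_j=\sum_{i=1}^m b_ia_{ij}$ for $j=1,\dots,l$ and $y_i=\sum_{j=1}^l x_ja_{ij}$ for $i=1,\dots,m$ (in matrix form, $\mathbf{a}=\mathbf{b}\mathbf{A}$ and $\mathbf{y}=\mathbf{x}\mathbf{A}^T$). *)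

(* Defs.v *)
From mathcomp Require Import all_boot all_order all_algebra.
From mathcomp Require Import reals.

Set Implicit Arguments.
Unset Strict Implicit.
Unset Printing Implicit Defensive.

Import Order.TTheory GRing.Theory Num.Theory.
Local Open Scope ring_scope.

(* A function on [alpha, beta] is encoded as a total f : R -> R of which only
   the values on [alpha, beta] are constrained. *)
Definition strongly_convex (R : realType) (alpha beta c : R) (f : R -> R) : Prop :=
  forall x y lambda : R,
    x \in `[alpha, beta] -> y \in `[alpha, beta] -> lambda \in `[0, 1] ->
    f (lambda * x + (1 - lambda) * y) <=
      lambda * f x + (1 - lambda) * f y
      - c * lambda * (1 - lambda) * (x - y) ^+ 2.

Definition row_stochastic (R : realType) (m l : nat) (A : 'M[R]_(m, l)) : Prop :=
  (forall i j, 0 <= A i j) /\ (forall i, \sum_(j < l) A i j = 1).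

(* (y, b) is majorized by (x, a) *)
Definition weighted_majorization (R : realType) (m l : nat)
    (y b : 'rV[R]_m) (x a : 'rV[R]_l) : Prop :=
  exists A : 'M[R]_(m, l),
    [/\ row_stochastic A, a = b *m A & y = x *m A^T].

(* Main.v *)
(** Summing [a = b *m A] over columns, row stochasticity gives
    [\sum_j a_j = \sum_i b_i = B_m], so the right-hand side is the [a]-weighted
    sum over [j] of the chord bound for [f] at [x_j], i.e. of strong convexity
    between the endpoints [alpha] and [beta]. *)
Require Import Defs.
From mathcomp Require Import all_boot all_order all_algebra.
From mathcomp Require Import reals.
From mathcomp Require Import ring.

Import Order.TTheory GRing.Theory Num.Theory.
Local Open Scope ring_scope.

(** Strong convexity is applied only to the pair [alpha], [beta]: the factor [(alpha - beta) ^+ 2]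
    cancels the denominators of the two weights, leaving [(beta - t) * (t - alpha)]. *)
Lemma strongly_convex_chord {R : realType} {alpha beta c t : R} {f : R -> R} :
  alpha < beta -> strongly_convex alpha beta c f -> t \in `[alpha, beta] ->
  f t <= (beta - t) / (beta - alpha) * f alpha
         + (t - alpha) / (beta - alpha) * f beta - c * ((beta - t) * (t - alpha)).
Proof.
move=> ltab hf; rewrite in_itv /= => /andP[leat letb].
have d_gt0 : 0 < beta - alpha by rewrite subr_gt0.
have d_neq0 : beta - alpha != 0 by rewrite gt_eqF.
(* The weight for which [t = lam * alpha + (1 - lam) * beta]. *)
set lam := (beta - t) / (beta - alpha).
have lamE : 1 - lam = (t - alpha) / (beta - alpha) by rewrite /lam; field.
have lamI : lam \in `[0, 1].
  rewrite in_itv /= -[lam <= 1]subr_ge0 lamE.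
  by rewrite !divr_ge0 ?subr_ge0 // ltW.
have leab := ltW ltab.
have := hf alpha beta lam.
rewrite lamE !in_itv /= !lexx leab => /(_ isT isT lamI).
have -> : lam * alpha + (t - alpha) / (beta - alpha) * beta = t
  by rewrite /lam; field.
have -> // : c * lam * ((t - alpha) / (beta - alpha)) * (alpha - beta) ^+ 2
             = c * ((beta - t) * (t - alpha)).
by rewrite /lam; field.
Qed.

Lemma weighted_majorization_sum {R : realType} {m l : nat}
    {y b : 'rV[R]_m} {x a : 'rV[R]_l} :
  weighted_majorization y b x a -> \sum_(j < l) a 0 j = \sum_(i < m) b 0 i.
Proof.
case=> A [[_ A1] -> _]; under eq_bigr do rewrite mxE.
by rewrite exchange_big; apply: eq_bigr => i _; rewrite -mulr_sumr A1 mulr1.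
Qed.

Theorem theorem3 (R : realType) (l m : nat) (alpha beta : R)
    (halphabeta : alpha < beta)
    (x a : 'rV[R]_l) (y b : 'rV[R]_m)
    (hx : forall j, x 0 j \in `[alpha, beta])
    (hy : forall i, y 0 i \in `[alpha, beta])
    (ha : forall j, 0 <= a 0 j)
    (hb : forall i, 0 <= b 0 i)
    (hmaj : weighted_majorization y b x a)
    (f : R -> R) (c : R) (hc : 0 < c)
    (hf : strongly_convex alpha beta c f) :
  \sum_(j < l) a 0 j * f (x 0 j) <=
    ((\sum_(i < m) b 0 i) * beta - \sum_(j < l) a 0 j * x 0 j) / (beta - alpha) * f alpha
    + (\sum_(j < l) a 0 j * x 0 j - (\sum_(i < m) b 0 i) * alpha) / (beta - alpha) * f beta
    - c * \sum_(j < l) a 0 j * (beta - x 0 j) * (x 0 j - alpha).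
Proof.
(* With [B_m] written as the sum of the [a 0 j], the right-hand side merges into one sum over [j],
   and the inequality can be checked term by term. *)
rewrite -(weighted_majorization_sum hmaj) !mulr_suml mulr_sumr -!sumrB.
rewrite !mulr_suml -big_split -sumrB /=; apply: ler_sum => j _.
(* Each term is the chord bound at [x 0 j] scaled by the nonnegative weight [a 0 j]. *)
have := ler_wpM2l (ha j) (strongly_convex_chord halphabeta hf (hx j)).
by congr (_ <= _); ring.
Qed.
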